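(* Let $A$ be a poset with greatest element $1$ and let $\to$ be a binary operation on $A$. Then $\to$ is a relative pseudocomplementation on $A$ if and only if it satisfies the following three conditions for all $x,y,z,u\in A$: (i) if $x\le y\to z$, then $y\le x\to z$; (ii) if $x\le x\to y$, then $x\le y$; (iii) if every $v\in A$ with $v\le x$ and $v\le u$ satisfies $v\le y$, then $u\le x\to y$.
   Context: A binary operation $\to$ on a poset $A$ with greatest element $1$ is a relative pseudocomplementation if for all $x,y,u\in A$: (R1) if $u\le x\to y$, then every $v$ with $v\le x$ and $v\le u$ satisfies $v\le y$; and (R2) if every $v$ with $v\le x$ and $v\le u$ satisfies $v\le y$, then $u\le x\to y$. *)

(* Defs.v *)
From Stdlib Require Import Relation_Definitions.

Definition greatest {A : Type} (le : relation A) (one : A) : Prop :=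
  forall x : A, le x one.

(* [A] need not have meets, so "the meet of x and u lies below y" is expressed
   by quantifying over the common lower bounds of x and u. *)
Definition relative_pseudocomplementation
    {A : Type} (le : relation A) (imp : A -> A -> A) : Prop :=
  (forall x y u : A,
     le u (imp x y) -> forall v : A, le v x -> le v u -> le v y) /\
  (forall x y u : A,
     (forall v : A, le v x -> le v u -> le v y) -> le u (imp x y)).

(* Main.v *)
Require Import Defs.
From Stdlib Require Import Relation_Definitions.

(** Condition (iii) is R2 itself, so R1 must be matched with (i) and (ii). Common lower bounds are
    symmetric in the two elements, which gives (i); (ii) is R1 at [u = v = x]. Conversely, (i) and
    transitivity let a common lower bound [v] replace both [u] and [x] in [u <= x -> y], and (ii)
    contracts [v <= v -> y]. *)

Theorem theorem3p5 (A : Type) (le : relation A) (one : A) (imp : A -> A -> A)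
    (le_order : order A le) (le_one : greatest le one) :
  relative_pseudocomplementation le imp <->
  (forall x y z : A, le x (imp y z) -> le y (imp x z)) /\
  (forall x y : A, le x (imp x y) -> le x y) /\
  (forall x y u : A,
     (forall v : A, le v x -> le v u -> le v y) -> le u (imp x y)).
Proof.
  destruct le_order as [refl trans _].
  split.
  - intros [R1 R2]; repeat split.
    + intros x y z Hx; apply R2; intros v Hvx Hvy.
      exact (R1 y z x Hx v Hvy Hvx).
    + intros x y Hx; exact (R1 x y x Hx x (refl x) (refl x)).
    + exact R2.
  - intros [exch [contr R2]]; split; [| exact R2].
    intros x y u Hu v Hvx Hvu.
    (* [v <= u <= x -> y] exchanges to [x <= v -> y], so [v <= x <= v -> y]. *)
    apply contr, (trans v x); [exact Hvx |].
    apply exch, (trans v u); assumption.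
Qed.
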